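(* Let $G$ be a locally finite vertex-transitive graph such that $\mu_p<\mu_w$. Then there exist $\varepsilon>0$ and $c>0$ such that $$\mathbb{P}_n\big(d(o,\omega(n))\ge \varepsilon n\big)\ge 1-e^{-cn}$$ for every $n\ge 0$.
   Context: Fix a vertex $o$ of $G$. $d(\cdot,\cdot)$ denotes the graph distance in $G$. A walk of length $n$ in $G$ is a sequence of vertices $(\omega(0),\dots,\omega(n))$ with $\omega(i),\omega(i+1)$ adjacent for every $0\le i\le n-1$. A self-avoiding walk (SAW) is a walk all of whose vertices are distinct. A self-avoiding polygon (SAP) of length $n$ is a walk with $\omega(0)=\omega(n)$ and all other vertices distinct (from each other and from $\omega(0)$); two SAPs are identified when they have the same set of edges (so SAPs are the cycles of the graph). Let $c_n$ be the number of SAWs of length $n$ starting at $o$, and $p_n$ the number of SAPs of length $n$ containing $o$. The connective constants are $$\mu_w:=\limsup_{n\to\infty}(c_n)^{1/n},\qquad \mu_p:=\limsup_{n\to\infty}(p_n)^{1/n}.$$ $\mathbb{P}_n$ is the uniform probability measure on SAWs of length $n$ in $G$ starting at $o$, and $(\omega(0),\dots,\omega(n))$ is the random SAW sampled from $\mathbb{P}_n$. *)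

(* Defs.v *)
From mathcomp Require Import all_boot all_order all_algebra finmap.
From mathcomp Require Import all_classical all_reals all_analysis.

Set Implicit Arguments.
Unset Strict Implicit.
Unset Printing Implicit Defensive.

Import Order.TTheory GRing.Theory Num.Theory.

Local Open Scope classical_set_scope.
Local Open Scope ring_scope.

(* A graph is a type of vertices V with a symmetric irreflexive adjacency
   relation e.  A walk (w(0), ..., w(n)) of length n is an (n+1)-tuple. *)

Definition locally_finite (V : choiceType) (e : rel V) : Prop :=
  forall x : V, finite_set [set y | e x y].

Definition automorphism (V : choiceType) (e : rel V) (f : V -> V) : Prop :=
  bijective f /\ forall x y : V, e (f x) (f y) = e x y.

Definition vertex_transitive (V : choiceType) (e : rel V) : Prop :=
  forall x y : V, exists2 f : V -> V, automorphism e f & f x = y.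

Definition is_walk (V : choiceType) (e : rel V) (n : nat)
  (w : n.+1.-tuple V) : bool := sorted e w.

Definition startpoint (V : choiceType) (n : nat) (w : n.+1.-tuple V) : V :=
  tnth w ord0.

Definition endpoint (V : choiceType) (n : nat) (w : n.+1.-tuple V) : V :=
  tnth w ord_max.

(* Extended-real valued: the distance between distinct components is +oo. *)
Definition graph_dist (R : realType) (V : choiceType) (e : rel V) (x y : V) :
    \bar R :=
  ereal_inf [set (n%:R)%:E | n in [set n : nat | exists w : n.+1.-tuple V,
    [/\ is_walk e w, startpoint w = x & endpoint w = y]]].

Definition is_saw (V : choiceType) (e : rel V) (n : nat)
  (w : n.+1.-tuple V) : bool := is_walk e w && uniq w.

(* [behead w] lists w(1), ..., w(n), and w(n) = w(0). *)
Definition is_sap (V : choiceType) (e : rel V) (n : nat)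
    (w : n.+1.-tuple V) : bool :=
  [&& is_walk e w, startpoint w == endpoint w & uniq (behead w)].

Definition walk_edges (V : choiceType) (n : nat) (w : n.+1.-tuple V) :
    {fset {fset V}} :=
  [fset [fset p.1; p.2]%fset | p in zip w (behead w)]%fset.

Definition saws (V : choiceType) (e : rel V) (o : V) (n : nat) :
    set (n.+1.-tuple V) :=
  [set w | is_saw e w /\ startpoint w = o].
Arguments saws {V} e o n.

(* Two polygons are identified when they have the same edges. *)
Definition saps (V : choiceType) (e : rel V) (o : V) (n : nat) :
    set {fset {fset V}} :=
  [set walk_edges w | w in [set w : n.+1.-tuple V | is_sap e w /\ o \in w]].
Arguments saps {V} e o n.

(* [fset_set] is only meaningful on finite sets; local finiteness of e makes
   [saws e o n] and [saps e o n] finite. *)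
Definition saw_count (V : choiceType) (e : rel V) (o : V) (n : nat) : nat :=
  #|` fset_set (saws e o n)|.

Definition sap_count (V : choiceType) (e : rel V) (o : V) (n : nat) : nat :=
  #|` fset_set (saps e o n)|.

Definition mu_w (R : realType) (V : choiceType) (e : rel V) (o : V) : \bar R :=
  limn_esup (fun n : nat => (((saw_count e o n)%:R : R) `^ n%:R^-1)%:E).

Definition mu_p (R : realType) (V : choiceType) (e : rel V) (o : V) : \bar R :=
  limn_esup (fun n : nat => (((sap_count e o n)%:R : R) `^ n%:R^-1)%:E).

(* Probability of the event A under the uniform measure on [saws e o n]. *)
Definition saw_prob (R : realType) (V : choiceType) (e : rel V) (o : V)
    (n : nat) (A : set (n.+1.-tuple V)) : R :=
  #|` fset_set (saws e o n `&` A)|%:R / (saw_count e o n)%:R.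

(* Main.v *)
Require Import Defs.
From mathcomp Require Import all_boot all_order all_algebra finmap.
From mathcomp Require Import all_classical all_reals all_analysis.
From mathcomp Require Import ring lra.

(** Write N(x, y, n) for the number of self-avoiding walks of length n from x
to y, p_n for the number of polygons of length n through a vertex, and c_n for
the number of self-avoiding walks of length n from o.

The heart of the proof is a recursion that moves the end of a walk along an
edge ([sawto_step]).  Let y and v be adjacent, and append v to a self-avoiding
walk from x to y.  Either the result is again self-avoiding, or v was already
visited, at time j say; then what follows time j closes up to a polygon of
length n + 1 - j through v, and what precedes it is a self-avoiding walk of
length j from x to v.  Hence
   N(x, y, n) <= N(x, v, n + 1) + sum_(j <= n) N(x, v, j) p_(n + 1 - j).
Take a > mu_p, so that the sums of p_l / a^l are bounded by some P.  Iterating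
the recursion along a path of length k from x to y, and starting from
N(x, x, n) <= a^n, gives N(x, y, n) <= B^k a^n with B = a (1 + P)
([sawto_bound]).  So walks with nearby endpoints grow at rate a only, up to a
cost that is exponential in the distance of the endpoints and not in n.

If also a < r < mu_w, then c_n >= r^n by submultiplicativity
([submul_growth]).  A walk whose end lies at distance less than eps n from o
ends at the end of a self-avoiding walk of length at most K <= eps n.  There are
at most c_1^k of these of length k, so the number of such walks is at most
M^(2 K) a^n for a constant M ([ncard_near_le]).  For eps small, M^(2 eps)
is at most the square root of r / a, and the proportion of such walks among
all c_n >= r^n decays exponentially ([exp_gap]). *)

Set Implicit Arguments.
Unset Strict Implicit.
Unset Printing Implicit Defensive.

Import Order.TTheory GRing.Theory Num.Theory.

Local Open Scope classical_set_scope.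
Local Open Scope ring_scope.

(** * Cardinals of finite sets *)

Definition ncard (T : choiceType) (A : set T) : nat := #|` fset_set A|.

Lemma ncard_le_inj (T U : choiceType) (f : T -> U) (A : set T) (B : set U) :
  finite_set B -> {in A &, injective f} -> (forall x, A x -> B (f x)) ->
  (ncard A <= ncard B)%N.
Proof.
move=> finB injf fAB; rewrite /ncard.
(* [fset_set] sends an infinite set to the empty one. *)
have [finA|infA] := pselect (finite_set A); last first.
  by rewrite {1}/fset_set; case: pselect.
have injf' : {in fset_set A &, injective f}.
  by move=> x y; rewrite !in_fset_set // => Ax Ay; apply: injf.
rewrite -(card_in_imfset imfset_key injf').
apply/fsubset_leq_card/fsubsetP => _ /imfsetP[x /= + ->].
by rewrite !in_fset_set // !inE; apply: fAB.
Qed.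

Lemma ncard_le (T : choiceType) (A B : set T) :
  finite_set B -> A `<=` B -> (ncard A <= ncard B)%N.
Proof. by move=> finB AB; apply: (@ncard_le_inj _ _ id). Qed.

Lemma ncard_setX (T U : choiceType) (A : set T) (B : set U) :
  finite_set A -> finite_set B -> (ncard (A `*` B) <= ncard A * ncard B)%N.
Proof.
move=> fA fB; rewrite /ncard fset_setX //.
rewrite -(size_allpairs (fun x y => (x, y))).
apply: uniq_leq_size; first exact: fset_uniq.
move=> [x y]; rewrite in_fsetM /= => /andP[xA yB].
by apply/allpairsP; exists (x, y).
Qed.

Lemma ncard_setU (T : choiceType) (A B C : set T) :
  finite_set B -> finite_set C -> A `<=` B `|` C ->
  (ncard A <= ncard B + ncard C)%N.
Proof.
move=> fB fC ABC; apply: leq_trans (ncard_le _ ABC) _.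
  by rewrite finite_setU.
by rewrite /ncard fset_setU // cardfsU leq_subr.
Qed.

Lemma ncard_cover (T I : choiceType) (s : seq I) (A : set T) (F : I -> set T) :
  (forall i, i \in s -> finite_set (F i)) ->
  (forall x, A x -> exists2 i, i \in s & F i x) ->
  (ncard A <= \sum_(i <- s) ncard (F i))%N.
Proof.
elim: s A => [|i s IH] A finF cov.
  have -> : A = set0 by rewrite -subset0 => x /cov[].
  by rewrite /ncard fset_set0 cardfs0.
have finFs j : j \in s -> finite_set (F j).
  by move=> js; apply: finF; rewrite inE js orbT.
have finU : finite_set (\bigcup_(j in [set` s]) F j).
  by apply: bigcup_finite => //; exact: finite_seq.
rewrite big_cons; apply: leq_trans (@ncard_setU _ _ (F i) _ _ finU _) _.
- by apply: finF; rewrite mem_head.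
- move=> x /cov[j]; rewrite in_cons => /orP[/eqP->|js] Fjx; first by left.
  by right; exists j.
by rewrite leq_add2l; apply: IH => // x [j js Fjx]; exists j.
Qed.

(** * Self-avoiding walks and the edges of paths *)

(** A walk is encoded by the list of its vertices after the starting point [x];
this avoids the dependent tuple types when walks are cut and extended. *)
Definition sawfrom (V : choiceType) (e : rel V) (x : V) (n : nat) :
  set (seq V) := [set s | [/\ path e x s, uniq (x :: s) & size s = n]].

Definition sawto (V : choiceType) (e : rel V) (x y : V) (n : nat) :
  set (seq V) := [set s | sawfrom e x n s /\ last x s = y].

Definition path_edges (V : choiceType) (x : V) (s : seq V) :
  {fset {fset V}} := [fset [fset p.1; p.2]%fset | p in zip (x :: s) s]%fset.

Lemma path_edges_nil (V : choiceType) (x : V) : path_edges x [::] = fset0.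
Proof. by apply/fsetP => E; apply/imfsetP; rewrite inE => -[]. Qed.

Lemma path_edges_cons (V : choiceType) (x y : V) (s : seq V) :
  path_edges x (y :: s) = ([fset x; y] |` path_edges y s)%fset.
Proof.
apply/fsetP => E; rewrite in_fset1U; apply/imfsetP/idP => /=.
  move=> [p]; rewrite in_cons => /orP[/eqP -> ->|ps ->]; first by rewrite eqxx.
  by apply/orP; right; apply/imfsetP; exists p.
case/orP => [/eqP ->|/imfsetP[p /= ps ->]].
  by exists (x, y); rewrite ?mem_head.
by exists p => //; rewrite in_cons ps orbT.
Qed.

Lemma path_edges_rcons (V : choiceType) (x y : V) (s : seq V) :
  path_edges x (rcons s y) = ([fset last x s; y] |` path_edges x s)%fset.
Proof.
elim: s x => [|z s IH] x /=.
  by rewrite path_edges_cons.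
by rewrite !path_edges_cons IH fsetUCA.
Qed.

Lemma mem_path_edges (V : choiceType) (x : V) (s : seq V) (E : {fset V}) z :
  E \in path_edges x s -> z \in E -> z \in x :: s.
Proof.
elim: s x => [|y s IH] x; first by rewrite path_edges_nil.
rewrite path_edges_cons in_fset1U => /orP[/eqP ->|/IH{}IH zE].
  by rewrite !inE => /orP[] ->; rewrite ?orbT.
by rewrite inE IH // orbT.
Qed.

Lemma fset2_inj (V : choiceType) (x y z : V) :
  [fset x; y]%fset = [fset x; z]%fset -> y = z.
Proof.
move=> /fsetP E; move: (fset22 x y); rewrite E => /fset2P[yx|//].
by move: (fset22 x z); rewrite -E => /fset2P[->|->].
Qed.

Lemma path_edges_head (V : choiceType) (x y z : V) (s : seq V) :
  uniq (x :: y :: s) -> ([fset x; z]%fset \in path_edges x (y :: s)) -> z = y.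
Proof.
rewrite cons_uniq => /andP[xs _].
rewrite path_edges_cons in_fset1U => /orP[/eqP/fset2_inj //|].
by move=> /mem_path_edges /(_ (fset21 _ _)); rewrite (negPf xs).
Qed.

(** The starting vertex lies on the first edge only, so the edge set determines
the second vertex, and then, without that edge, the rest of the walk. *)
Lemma path_edges_inj (V : choiceType) (x : V) (s t : seq V) :
  uniq (x :: s) -> uniq (x :: t) -> path_edges x s = path_edges x t -> s = t.
Proof.
have cons_neq0 (y : V) u (z : V) :
    path_edges z (y :: u) <> fset0.
  by move/fsetP/(_ [fset z; y]%fset); rewrite path_edges_cons !inE eqxx.
elim: s x t => [|y s IH] x [|z t] us ut //.
- by rewrite path_edges_nil => /esym/cons_neq0.
- by rewrite path_edges_nil => /cons_neq0.
move=> E; have yz : y = z.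
  by apply: (path_edges_head ut); rewrite -E path_edges_cons fset1U1.
subst z; congr cons; have nin (u : seq V) : uniq (x :: y :: u) ->
    [fset x; y]%fset \notin path_edges y u.
  rewrite cons_uniq => /andP[xu _]; apply/negP.
  by move=> /mem_path_edges /(_ (fset21 _ _)); rewrite (negPf xu).
have [us' ut'] : uniq (y :: s) /\ uniq (y :: t).
  move: us ut; rewrite cons_uniq => /andP[_ ->].
  by rewrite cons_uniq => /andP[].
apply: (IH y) => //.
move: E; rewrite !path_edges_cons => E.
by rewrite -[LHS](fsetU1K (nin _ us)) E fsetU1K // nin.
Qed.

(** A polygon through the edge [{x, y}], traversed so that this edge comes last,
is determined by its edges.  If the walk has length at least two, the closing
edge is not one of its own edges, since its second vertex is not its last, and
removing it leaves the edges of the walk.  A walk of length at most one is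
determined by its endpoints; a backtracking path along one edge counts as a
polygon of length two. *)
Lemma polygon_edges_inj (V : choiceType) (x y : V) (s t : seq V) :
  uniq (x :: s) -> uniq (x :: t) -> last x s = y -> last x t = y ->
  size s = size t -> path_edges x (rcons s x) = path_edges x (rcons t x) ->
  s = t.
Proof.
move=> us ut ls lt st E.
case: s us ls st E => [|a [|b s]] us ls st E.
- by case: t st {E lt ut}.
- by case: t st E lt {ut} => [|c []] //= _ _ ->; rewrite -ls.
have closing (u : seq V) a' b' : uniq (x :: a' :: b' :: u) ->
    last x [:: a', b' & u] = y -> [fset y; x]%fset \notin
    path_edges x [:: a', b' & u].
  move=> uu lu; apply/negP; rewrite fsetUC => /(path_edges_head uu) ya.
  move: uu; rewrite cons_uniq => /andP[_]; rewrite cons_uniq => /andP[/negP]/=.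
  by rewrite -ya -lu /= mem_last.
case: t ut lt st E => [|c [|d t]] // ut lt st.
rewrite !path_edges_rcons ls lt => E.
apply: (path_edges_inj us ut).
by rewrite -[LHS](fsetU1K (closing _ _ _ us ls)) E fsetU1K // closing.
Qed.

(** * Finiteness and counting *)

Lemma finite_walks (V : choiceType) (e : rel V) (x : V) (n : nat) :
  locally_finite e -> finite_set [set s | path e x s /\ size s = n].
Proof.
move=> lf; elim: n x => [|n IH] x.
  by apply: (@sub_finite_set _ _ [set [::]]) => [s [_ /size0nil]|//].
apply: (@sub_finite_set _ _ (\bigcup_(y in [set y | e x y])
    (cons y @` [set s | path e y s /\ size s = n]))).
  by move=> [|y s] [] //= /andP[exy ps] [sz]; exists y => //; exists s.
by apply: bigcup_finite => [|y _]; [exact: lf|exact: finite_image].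
Qed.

Lemma finite_sawfrom (V : choiceType) (e : rel V) (x : V) (n : nat) :
  locally_finite e -> finite_set (sawfrom e x n).
Proof.
by move=> lf; apply: sub_finite_set (finite_walks x n lf) => s [].
Qed.

Lemma finite_sawto (V : choiceType) (e : rel V) (x y : V) (n : nat) :
  locally_finite e -> finite_set (sawto e x y n).
Proof.
by move=> lf; apply: sub_finite_set (finite_sawfrom x n lf) => s [].
Qed.

Lemma startpointE (V : choiceType) n (w : n.+1.-tuple V) x s :
  val w = x :: s -> startpoint w = x.
Proof. by rewrite /startpoint (tnth_nth x) /= => ->. Qed.

Lemma endpointE (V : choiceType) n (w : n.+1.-tuple V) x s :
  val w = x :: s -> endpoint w = last x s.
Proof.
move=> E; have [sz] : (size s).+1 = n.+1 by rewrite -(size_tuple w) E.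
by rewrite /endpoint (tnth_nth x) /= E -[in LHS]sz -last_nth.
Qed.

(** The representative of a polygon may start anywhere.  Its part after the
visit to [o] leads from [o] to its starting point, which therefore lies in a
finite ball around [o]. *)
Lemma finite_saps (V : choiceType) (e : rel V) (o : V) (n : nat) :
  locally_finite e -> finite_set (saps e o n).
Proof.
move=> lf; apply: (@sub_finite_set _ _ (\bigcup_(i in `I_n.+1)
    \bigcup_(t in [set t | path e o t /\ size t = i])
    (path_edges (last o t) @` [set s | path e (last o t) s /\ size s = n]))).
  move=> E [w [/and3P[walk_w close_w _] ow] <-].
  case Ew : (val w) => [|x s]; first by have := size_tuple w; rewrite Ew.
  have sz : size s = n by have := size_tuple w; rewrite Ew => -[].
  move: close_w; rewrite (startpointE Ew) (endpointE Ew) => /eqP xs.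
  move: walk_w; rewrite /is_walk Ew /= => pws.
  have [s1 [s2 [ps lo]]] : exists s1 s2, s = s1 ++ s2 /\ last x s1 = o.
    move: ow; rewrite memtE Ew => os.
    by case/splitPl: {s Ew sz xs pws} os => s1 s2 ls1; exists s1, s2.
  move: pws; rewrite ps cat_path lo => /andP[p1 p2].
  have l2 : last o s2 = x by rewrite xs ps last_cat lo.
  exists (size s2).
    by rewrite /= ltnS -sz ps size_cat leq_addl.
  exists s2 => //; exists s; last by rewrite l2 /walk_edges /path_edges Ew.
  by rewrite l2; split=> //; rewrite ps cat_path lo p1.
apply: bigcup_finite => [|i _]; first exact: finite_II.
apply: bigcup_finite => [|t _]; first exact: finite_walks.
exact/finite_image/finite_walks.
Qed.

Lemma sawsP (V : choiceType) (e : rel V) (o : V) (n : nat)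
    (w : n.+1.-tuple V) :
  saws e o n w -> exists2 s, val w = o :: s & sawfrom e o n s.
Proof.
rewrite /saws /= /is_saw /is_walk => -[].
case Ew : (val w) => [|x s]; first by have := size_tuple w; rewrite Ew.
have sz : size s = n by have := size_tuple w; rewrite Ew => -[].
by rewrite (startpointE Ew) => /andP[pw uw] xo; subst x; exists s.
Qed.

Lemma ncard_saws_le (V : choiceType) (e : rel V) (o : V) (n : nat)
    (A : set (n.+1.-tuple V)) (B : set (seq V)) :
  finite_set B ->
  (forall w s, saws e o n w -> A w -> val w = o :: s -> B s) ->
  (ncard (saws e o n `&` A) <= ncard B)%N.
Proof.
move=> finB AB; apply: (@ncard_le_inj _ _ (fun w => behead (val w))) => //.
  move=> w w'; rewrite !inE => -[/sawsP[s Es _] _] [/sawsP[s' Es' _] _].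
  by rewrite Es Es' /= => ss; apply/val_inj; rewrite Es Es' ss.
by move=> w [sw Aw]; have [s Es _] := sawsP sw; rewrite Es; apply: (AB w).
Qed.

Lemma saw_countE (V : choiceType) (e : rel V) (o : V) (n : nat) :
  locally_finite e ->
  finite_set (saws e o n) /\ saw_count e o n = ncard (sawfrom e o n).
Proof.
move=> lf; pose tup s : n.+1.-tuple V := insubd [tuple of nseq n.+1 o] (o :: s).
have tupE s : size s = n -> val (tup s) = o :: s.
  by move=> sz; rewrite val_insubd /= sz eqxx.
have finS : finite_set (saws e o n).
  apply: sub_finite_set (finite_image tup (finite_sawfrom o n lf)) => w.
  move=> /sawsP[s Es ss]; exists s => //.
  by apply/val_inj; rewrite Es tupE //; case: ss.
split=> //; apply/eqP; rewrite eqn_leq; apply/andP; split.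
  rewrite /saw_count -/(ncard _) -[saws e o n]setIT.
  apply: ncard_saws_le; first exact: finite_sawfrom.
  by move=> w s /sawsP[t -> ss] _ [<-].
apply: (@ncard_le_inj _ _ tup) => //.
  move=> s t; rewrite !inE => -[_ _ sz] [_ _ tz] /(congr1 val).
  by rewrite !tupE // => -[].
move=> s [ps us sz]; split; last by rewrite (startpointE (tupE _ sz)).
by rewrite /is_saw /is_walk tupE //= ps.
Qed.

(** * Moving the end of a walk along an edge *)

Lemma sawto_take (V : choiceType) (e : rel V) (x y v : V) (n j : nat) s :
  (j <= n)%N -> sawto e x y n s -> nth x (x :: s) j = v ->
  [/\ sawto e x v j (take j s), path e v (drop j s),
      uniq (v :: drop j s), last v (drop j s) = y
    & size (drop j s) = (n - j)%N].
Proof.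
move=> jn [[ps us sz] ls] sj.
have js : (j <= size s)%N by rewrite sz.
have szt : size (take j s) = j by rewrite size_takel.
have lj : last x (take j s) = v.
  rewrite (last_nth x) szt -sj.
  by rewrite -[x :: take j s]/(take j.+1 (x :: s)) nth_take.
move: ps; rewrite -{1}(cat_take_drop j s) cat_path lj => /andP[p1 p2].
split=> //.
- split=> //; split=> //.
  by rewrite -[x :: take j s]/(take j.+1 (x :: s)); apply: take_uniq.
- have -> : v :: drop j s = drop j (x :: s); last exact: drop_uniq.
  by rewrite [RHS](drop_nth x) ?sj.
- by rewrite -ls -{2}(cat_take_drop j s) last_cat lj.
- by rewrite size_drop sz.
Qed.

(** The automorphism [f] carries the polygon obtained by closing [s] to one
through the image of [v], so that all polygons can be counted at one vertex. *)
Lemma path_edges_saps (V : choiceType) (e : rel V) (f : V -> V) (v y : V) s :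
  injective f -> (forall a b, e (f a) (f b) = e a b) ->
  path e v s -> uniq (v :: s) -> last v s = y -> e y v ->
  saps e (f v) (size s).+1 (path_edges (f v) (map f (rcons s v))).
Proof.
move=> finj fe ps us ls eyv.
have sz : size (map f (v :: rcons s v)) == (size s).+2.
  by rewrite size_map /= size_rcons.
pose w := Tuple sz.
have Ew : val w = f v :: map f (rcons s v) by [].
exists w => //; split; last by rewrite memtE Ew mem_head.
apply/and3P; split.
- by rewrite /is_walk Ew /= path_map (eq_path (e' := e)) ?rcons_path ?ps ?ls //.
- by rewrite (startpointE Ew) (endpointE Ew) map_rcons last_rcons eqxx.
- by rewrite Ew /= map_inj_uniq // rcons_uniq -cons_uniq.
Qed.

(** Loop erasure: append [v] to a walk ending at the neighbour [y], and if [v]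
was visited before, split off the loop that this closes. *)
Lemma sawto_step (V : choiceType) (e : rel V) (o x y v : V) (n : nat) :
  symmetric e -> locally_finite e -> vertex_transitive e -> e v y ->
  (ncard (sawto e x y n) <= ncard (sawto e x v n.+1) +
     \sum_(0 <= j < n.+1) ncard (sawto e x v j) * sap_count e o (n.+1 - j))%N.
Proof.
move=> esym lf vt evy.
have [f [/bij_inj finj fe] fvo] := vt v o.
pose A j := [set s | sawto e x y n s /\ nth x (x :: s) j = v].
have finA j : finite_set (A j).
  by apply: sub_finite_set (finite_sawto x y n lf) => s [].
have finU : finite_set [set s | exists2 j, (j < n.+1)%N & A j s].
  by apply: sub_finite_set (finite_sawto x y n lf) => s [j _ []].
have finN : finite_set [set s | sawto e x y n s /\ v \notin x :: s].
  by apply: sub_finite_set (finite_sawto x y n lf) => s [].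
apply: leq_trans (ncard_setU finN finU _) _.
  move=> s ss; have [vs|vs] := boolP (v \in x :: s); last by left.
  right; exists (index v (x :: s)); last by split=> //; rewrite nth_index.
  by move: vs; rewrite -index_mem /=; case: ss => -[_ _ ->].
apply: leq_add.
  apply: (@ncard_le_inj _ _ (rcons^~ v)); first exact: finite_sawto.
    by move=> s t _ _; apply: rcons_injl.
  move=> s [[[ps us sz] ls] vs]; split; last by rewrite last_rcons.
  split; last by rewrite size_rcons sz.
    by rewrite rcons_path ps ls esym.
  by rewrite -rcons_cons rcons_uniq vs.
apply: leq_trans (ncard_cover (s := index_iota 0 n.+1) (F := A) _ _) _ => //.
  by move=> s [j jn Ajs]; exists j => //; rewrite mem_index_iota.
rewrite big_seq [leqRHS]big_seq; apply: leq_sum => j.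
rewrite mem_index_iota /= ltnS => jn.
apply: leq_trans
  (ncard_setX (finite_sawto x v j lf) (finite_saps o (n.+1 - j) lf)).
apply: (@ncard_le_inj _ _ (fun s =>
    (take j s, path_edges (f v) (map f (rcons (drop j s) v))))).
- by apply: finite_setX; [exact: finite_sawto|exact: finite_saps].
- move=> s t; rewrite !inE => -[/(sawto_take jn)h /h{h}[_ _ us ls sz]].
  move=> [/(sawto_take jn)h /h{h}[_ _ ut lt tz]] [tk].
  rewrite !map_rcons => E.
  rewrite -(cat_take_drop j s) -(cat_take_drop j t) tk; congr cat.
  apply: (inj_map finj); apply: (polygon_edges_inj _ _ _ _ _ E).
  + by rewrite -map_cons map_inj_uniq.
  + by rewrite -map_cons map_inj_uniq.
  + by rewrite last_map ls.
  + by rewrite last_map lt.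
  + by rewrite !size_map sz tz.
- move=> s [/(sawto_take jn)h /h{h}[ss ps us ls sz]]; split=> //=.
  by rewrite -fvo subSn // -sz; apply: path_edges_saps ls _; rewrite // esym.
Qed.

(** Let [B := a * (1 + P)].  If the path has [k + 1] edges, induction bounds the
right-hand side of [sawto_step] by [B ^+ k * a ^+ n.+1 * (1 + P)]: the extended
walks account for the [1] and the polygons for the [P]. *)
Lemma sawto_bound (R : realType) (V : choiceType) (e : rel V) (o x : V)
    (a P : R) (t : seq V) (n : nat) :
  symmetric e -> locally_finite e -> vertex_transitive e -> 0 < a ->
  (forall L, \sum_(0 <= l < L) (sap_count e o l.+1)%:R / a ^+ l.+1 <= P) ->
  path e x t ->
  (ncard (sawto e x (last x t) n))%:R <= (a * (1 + P)) ^+ size t * a ^+ n.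
Proof.
move=> esym lf vt a0 hP.
have P0 : 0 <= P by have := hP 0%N; rewrite big_nil.
have B0 : 0 <= a * (1 + P) by rewrite mulr_ge0 ?addr_ge0 // ltW.
elim/last_ind: t n => [|t y IH] n.
  move=> _; rewrite expr0 mul1r /=; case: n => [|n].
    rewrite expr0 -[leRHS]/(1%:R) ler_nat -(cardfs1 ([::] : seq V)) -fset_set1.
    by apply: ncard_le => // s [[_ _ /size0nil]].
  suff -> : sawto e x x n.+1 = set0.
    by rewrite /ncard fset_set0 cardfs0 exprn_ge0 // ltW.
  rewrite -subset0 => s [[_ + sz] ls]; case: s sz ls => //= z s _ <-.
  by rewrite mem_last.
rewrite rcons_path last_rcons => /andP[pt evy].
set v := last x t in evy *.
apply: le_trans (_ : _ <= (ncard (sawto e x v n.+1) +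
     \sum_(0 <= j < n.+1) ncard (sawto e x v j) *
        sap_count e o (n.+1 - j))%:R) _.
  by rewrite ler_nat; apply: sawto_step.
set B := a * (1 + P) in B0 IH *.
rewrite natrD natr_sum size_rcons.
have -> : B ^+ (size t).+1 * a ^+ n =
    B ^+ size t * a ^+ n.+1 + B ^+ size t * a ^+ n.+1 * P.
  by rewrite /B !exprSr; ring.
apply: lerD; first exact: IH.
apply: le_trans (_ : _ <= \sum_(0 <= j < n.+1) B ^+ size t * a ^+ j *
    (sap_count e o (n.+1 - j))%:R) _.
  by apply: ler_sum => j _; rewrite natrM ler_wpM2r // IH.
apply: le_trans (ler_wpM2l _ (hP n.+1)); last first.
  by rewrite mulr_ge0 ?exprn_ge0 // ltW.
rewrite mulr_sumr big_nat_rev /= big_nat [leRHS]big_nat; apply: ler_sum => j /=.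
rewrite ltnS => jn; rewrite add0n subSS subSn ?leq_subr // subKn //.
have -> : a ^+ n.+1 = a ^+ (n - j) * a ^+ j.+1 by rewrite -exprD addnS subnK.
have aj0 : a ^+ j.+1 != 0 by rewrite expf_neq0 // gt_eqF.
by rewrite le_eqVlt; apply/orP; left; apply/eqP; field.
Qed.

(** * Exponential growth rates *)

Lemma limn_esup_lt (R : realType) (u : nat -> \bar R) (x : \bar R) :
  (limn_esup u < x)%E ->
  exists N, forall n, (N <= n)%N -> (u n < x)%E.
Proof.
move=> /ereal_inf_lt[_ [A [N _ NA] <-]] sup_lt; exists N => n Nn.
apply: le_lt_trans sup_lt; apply: ereal_sup_ubound.
by exists n => //; apply: NA.
Qed.

Lemma limn_esup_le (R : realType) (u : nat -> \bar R) (x : \bar R) N :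
  (forall n, (N <= n)%N -> (u n <= x)%E) -> (limn_esup u <= x)%E.
Proof.
move=> ux; apply: ge_ereal_inf.
exists (ereal_sup (u @` [set n | (N <= n)%N])).
  by exists [set n | (N <= n)%N] => //; exists N.
by apply: ge_ereal_sup => _ [n Nn <-]; apply: ux.
Qed.

Lemma powR_invn_le (R : realType) (c r : R) (n : nat) :
  (0 < n)%N -> 0 <= c -> 0 <= r -> (c `^ n%:R^-1 <= r) = (c <= r ^+ n).
Proof.
move=> n0 c0 r0; rewrite -(@ler_pXn2r _ n) ?nnegrE ?powR_ge0 //.
rewrite -(powR_mulrn n (powR_ge0 c _)) -powRrM mulVf ?powRr1 //.
by rewrite pnatr_eq0 -lt0n.
Qed.

(** A limit superior bounds all but finitely many terms; the constant [C] takes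
care of the others. *)
Lemma growth_bound (R : realType) (u : nat -> nat) (a : R) :
  0 < a -> (limn_esup (fun n => ((u n)%:R `^ n%:R^-1)%:E) < a%:E)%E ->
  exists2 C : R, 0 < C & forall n, (u n)%:R <= C * a ^+ n.
Proof.
move=> a0 /limn_esup_lt[N HN].
have s0 m : 0 <= \sum_(i < m) (u i)%:R / a ^+ i.
  by rewrite sumr_ge0 // => i _; rewrite divr_ge0 ?exprn_ge0 // ltW.
(* The 1 serves the late terms, the sum each of the early ones. *)
exists (1 + \sum_(i < N.+1) (u i)%:R / a ^+ i); first by rewrite ltr_wpDr.
move=> n; have an := exprn_gt0 n a0.
have [nN|Nn] := ltnP n N.+1.
  rewrite -ler_pdivrMr // (bigD1 (Ordinal nN)) //= addrCA lerDl addr_ge0 //.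
  by rewrite sumr_ge0 // => i _; rewrite divr_ge0 ?exprn_ge0 // ltW.
apply: le_trans (_ : _ <= a ^+ n) _; last by rewrite ler_peMl ?lerDl // ltW.
rewrite -powR_invn_le ?ler0n ?(ltW a0) //; last by apply: leq_trans Nn.
by apply: ltW; rewrite -lte_fin; apply: HN; apply: ltnW.
Qed.

Lemma ereal_between_pos (R : realType) (x y : \bar R) :
  (0 <= x)%E -> (x < y)%E ->
  exists2 r : R, 0 < r & (x < r%:E < y)%E.
Proof.
case: x y => [x||] [y||] //=; rewrite ?lee_fin ?lte_fin => x0 xy.
- exists ((x + y) / 2); first by lra.
  by rewrite !lte_fin; apply/andP; split; lra.
- exists (x + 1); first by lra.
  by rewrite lte_fin ltry andbT; lra.
Qed.

(** If [u n < r ^+ n] for a single positive [n], submultiplicativity spreads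
this to [u m <= C * r ^+ m] for all [m], and the growth rate is at most [r].
The auxiliary rate between [r] and the growth rate absorbs [C]. *)
Lemma submul_growth (R : realType) (u : nat -> nat) (r : R) (n : nat) :
  (forall m n, (u (m + n) <= u m * u n)%N) -> 0 < r ->
  (r%:E < limn_esup (fun n => ((u n)%:R `^ n%:R^-1)%:E))%E ->
  (0 < n)%N -> r ^+ n <= (u n)%:R.
Proof.
move=> subu r0 r_lt n0; rewrite leNgt; apply/negP => un.
have [|r' r'0 /andP[rr' r'_lt]] := ereal_between_pos _ r_lt.
  by rewrite lee_fin ltW.
rewrite lte_fin in rr'.
have s0 m : 0 <= \sum_(i < m) (u i)%:R / r ^+ i.
  by rewrite sumr_ge0 // => i _; rewrite divr_ge0 ?exprn_ge0 // ltW.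
pose C := 1 + \sum_(i < n) (u i)%:R / r ^+ i.
have C0 : 0 < C by rewrite ltr_wpDr.
have uC m : (u m)%:R <= C * r ^+ m.
  elim/ltn_ind: m => m IH; have [mn|nm] := ltnP m n.
    rewrite -ler_pdivrMr ?exprn_gt0 // /C (bigD1 (Ordinal mn)) //=.
    rewrite addrCA lerDl addr_ge0 //.
    by rewrite sumr_ge0 // => i _; rewrite divr_ge0 ?exprn_ge0 // ltW.
  rewrite -(subnKC nm) exprD mulrCA.
  apply: (@le_trans _ _ (u n * u (m - n))%N%:R); first by rewrite ler_nat.
  rewrite natrM; apply: ler_pM => //; [exact: ltW|apply: IH].
  by rewrite ltn_subrL n0 (leq_trans n0).
have : \forall m \near \oo, (r / r') ^+ m < C^-1.
  have : `|r / r'| < 1.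
    by rewrite ger0_norm ?divr_ge0 ?ltW // ltr_pdivrMr // mul1r.
  move=> /cvg_expr /cvgr_lt; apply; by rewrite invr_gt0.
move=> [N _ HN]; move: r'_lt; apply/negP; rewrite -leNgt.
apply: (@limn_esup_le _ _ _ N.+1) => m Nm; rewrite lee_fin.
rewrite powR_invn_le ?ler0n ?(ltW r'0) //; last by apply: leq_trans Nm.
apply: le_trans (uC m) _.
have /= := HN m (ltnW Nm); rewrite expr_div_n.
rewrite ltr_pdivrMr ?exprn_gt0 // => /ltW.
by rewrite -(ler_pM2l C0) mulrA mulfV ?mul1r // gt_eqF.
Qed.


(** Comparison with a geometric series whose ratio is [b / a], for some [b]
between the growth rate and [a]. *)
Lemma power_series_bounded (R : realType) (u : nat -> nat) (a : R) :
  0 < a -> (0 <= limn_esup (fun n => ((u n)%:R `^ n%:R^-1 : R)%:E))%E ->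
  (limn_esup (fun n => ((u n)%:R `^ n%:R^-1)%:E) < a%:E)%E ->
  exists P : R, forall L, \sum_(0 <= l < L) (u l.+1)%:R / a ^+ l.+1 <= P.
Proof.
move=> a0 u0 /ereal_between_pos -/(_ u0)[b b0 /andP[ub ba]].
rewrite lte_fin in ba; have [C C0 uC] := growth_bound b0 ub.
pose q := b / a; have q0 : 0 < q by rewrite divr_gt0.
have q1 : `|q| < 1 by rewrite gtr0_norm // ltr_pdivrMr // mul1r.
exists (C * q * (1 - q)^-1) => L.
have Cq0 : 0 <= C * q by rewrite ltW // mulr_gt0.
apply: le_trans (geometric_le_lim L Cq0 q0 q1); apply: ler_sum => l _ /=.
rewrite ler_pdivrMr ?exprn_gt0 // -[C * q * _]mulrA -exprS /q expr_div_n.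
by rewrite -mulrA divfK // gt_eqF ?exprn_gt0.
Qed.

(** * Walks that end near their start *)

(** The part of a walk after time [m] is moved to [o] by an automorphism that
depends only on the vertex at time [m], hence on the part before. *)
Lemma saw_count_submul (V : choiceType) (e : rel V) (o : V) (m n : nat) :
  locally_finite e -> vertex_transitive e ->
  (saw_count e o (m + n) <= saw_count e o m * saw_count e o n)%N.
Proof.
move=> lf vt; rewrite !(saw_countE o _ lf).2.
have /choice[F HF] : forall y : V, exists f : V -> V,
    [/\ injective f, forall a b, e (f a) (f b) = e a b & f y = o].
  by move=> y; have [f [/bij_inj ? ?] ?] := vt y o; exists f.
apply: leq_trans (ncard_setX (finite_sawfrom o m lf) (finite_sawfrom o n lf)).
apply: (@ncard_le_inj _ _ (fun s =>
    (take m s, map (F (last o (take m s))) (drop m s)))).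
- by apply: finite_setX; exact: finite_sawfrom.
- move=> s t _ _ [st]; rewrite st => /(inj_map (let: And3 h _ _ := HF _ in h)).
  by move=> dst; rewrite -(cat_take_drop m s) -(cat_take_drop m t) st dst.
- move=> s [ps us sz].
  have mn : (m <= size s)%N by rewrite sz leq_addr.
  have szt : size (take m s) = m by rewrite size_takel.
  set y := last o (take m s); have [Fi Fe Fo] := HF y.
  have ym : nth o (o :: s) m = y.
    rewrite /y (last_nth o) szt.
    by rewrite -[(o :: take m s)]/(take m.+1 (o :: s)) nth_take.

  have ss : sawto e o (last o s) (m + n) s by [].
  have [[ts _] pd ud _ szd] := sawto_take (leq_addr n m) ss ym.
  split=> //; split => /=.
  + by rewrite -Fo path_map (eq_path (e' := e)) //= => a b; exact: Fe.
  + rewrite -[_ && _]/(uniq (o :: map (F y) (drop m s))).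
    by rewrite -{1}Fo -map_cons map_inj_uniq.
  + by rewrite size_map szd addKn.
Qed.

Lemma saw_count_le_exp (V : choiceType) (e : rel V) (o : V) (k : nat) :
  locally_finite e -> vertex_transitive e ->
  (saw_count e o k <= saw_count e o 1 ^ k)%N.
Proof.
move=> lf vt; elim: k => [|k IH].
  rewrite expn0 (saw_countE o 0 lf).2 -(cardfs1 ([::] : seq V)) -fset_set1.
  by apply: ncard_le => // s [_ _ /size0nil].
rewrite expnS -add1n; apply: leq_trans (saw_count_submul o 1 k lf vt) _.
by rewrite leq_mul2l IH orbT.
Qed.

Lemma sum_pow_le (R : realDomainType) (M : R) (K : nat) :
  2 <= M -> \sum_(1 <= k < K.+1) M ^+ k <= M ^+ (2 * K).
Proof.
move=> M2; have M1 : 1 <= M by apply: le_trans M2; rewrite ler1n.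
elim: K => [|K IH]; first by rewrite big_nil expr0 ler01.
rewrite big_nat_recr //=; apply: le_trans (lerD IH (lexx _)) _.
rewrite mulnS exprD exprS; set X := M ^+ (2 * K).
have XK : M ^+ K <= X by rewrite ler_weXn2l // leq_pmull.
have X0 : 0 <= X by apply: le_trans XK; rewrite exprn_ge0 //; lra.
have : X * (M - 2) >= 0 by rewrite mulr_ge0 //; lra.
have : X * (M - 2) * M >= 0 by rewrite !mulr_ge0 //; lra.
have : 0 <= M * (X - M ^+ K) by rewrite mulr_ge0 ?subr_ge0 //; lra.
rewrite expr2; nra.
Qed.

(** A path from [o] to the end of the walk can be made self-avoiding, so the
ends are counted with the self-avoiding walks of length [k <= K].  The case
[k = 0] does not occur since the walk has positive length and cannot return to
[o]; without it the bound holds with no constant factor, also for [K = 0]. *)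
Lemma ncard_near_le (R : realType) (V : choiceType) (e : rel V) (o : V)
    (a B M : R) (n K : nat) :
  locally_finite e -> vertex_transitive e -> 0 <= a -> 0 <= B -> 2 <= M ->
  (saw_count e o 1)%:R * B <= M -> (0 < n)%N ->
  (forall t, path e o t ->
    (ncard (sawto e o (last o t) n))%:R <= B ^+ size t * a ^+ n) ->
  (ncard [set s | sawfrom e o n s /\
     exists t, [/\ path e o t, last o t = last o s & (size t <= K)%N]])%:R <=
    M ^+ (2 * K) * a ^+ n.
Proof.
move=> lf vt a0 B0 M2 BM n0 bound.
have an := exprn_ge0 n a0.
pose F k := [set s | exists2 t, sawfrom e o k t & sawto e o (last o t) n s].
have finF k : finite_set (F k).
  by apply: sub_finite_set (finite_sawfrom o n lf) => s [t _ []].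
have Fle k : (ncard (F k))%:R <= M ^+ k * a ^+ n.
  have fink := finite_sawfrom o k lf.
  apply: (@le_trans _ _ (\sum_(t <- fset_set (sawfrom e o k))
     ncard (sawto e o (last o t) n))%N%:R).
    rewrite ler_nat; apply: ncard_cover => [t _|s [t ot ts]].
      exact: finite_sawto.
    by exists t => //; rewrite in_fset_set // inE.
  apply: (@le_trans _ _ ((saw_count e o k)%:R * (B ^+ k * a ^+ n))).
    rewrite (saw_countE o k lf).2 mulr_natl natr_sum.
    rewrite -[X in _ *+ X]count_predT -iter_addr_0 -big_const_seq.
    rewrite big_seq [leRHS]big_seq; apply: ler_sum => t.
    by rewrite in_fset_set // inE => -[pt _ <-]; exact: bound.
  rewrite mulrA ler_wpM2r //.
  apply: (@le_trans _ _ (((saw_count e o 1)%:R * B) ^+ k)); last first.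
    by apply: lerXn2r; rewrite ?nnegrE ?mulr_ge0 // (le_trans _ M2).
  by rewrite exprMn ler_wpM2r ?exprn_ge0 // -natrX ler_nat saw_count_le_exp.
apply: (@le_trans _ _ (\sum_(1 <= k < K.+1) ncard (F k))%N%:R).
  rewrite ler_nat; apply: ncard_cover => [k _|s [ss [t [pt lt tK]]]] //.
  case/shortenP: pt lt => t' pt' ut' t't lt.
  have t'_uniq : uniq t' by move: ut'; rewrite cons_uniq => /andP[].
  exists (size t'); last by exists t'.
  rewrite mem_index_iota ltnS (leq_trans (uniq_leq_size t'_uniq t't) tK) andbT.
  case: t' lt {pt' ut' t't t'_uniq} => //= lt.
  case: ss n0 lt => _; case: s => [_ <- //|z s us _ _ os].
  by move: us; rewrite cons_uniq os /= mem_last.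
rewrite natr_sum; apply: (@le_trans _ _ (\sum_(1 <= k < K.+1) M ^+ k * a ^+ n)).
  by apply: ler_sum => k _.
by rewrite -mulr_suml ler_wpM2r // sum_pow_le.
Qed.

Lemma graph_dist_ltP (R : realType) (V : choiceType) (e : rel V) (x y : V)
    (b : R) :
  (graph_dist R e x y < b%:E)%E ->
  exists t, [/\ path e x t, last x t = y & (size t)%:R < b].
Proof.
move=> /ereal_inf_lt[_ [n [w [pw xw yw]] <-]]; rewrite lte_fin => nb.
case Ew : (val w) => [|z t]; first by have := size_tuple w; rewrite Ew.
have sz : size t = n by have := size_tuple w; rewrite Ew => -[].
move: xw yw pw; rewrite (startpointE Ew) (endpointE Ew) /is_walk Ew /= => <-.
by move=> tl pt; exists t; rewrite sz.
Qed.

(** On a logarithmic scale, the factor [M ^+ (2 * K)] costs at most half of the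
gain [(r / a) ^+ n]; the other half is the decay rate. *)
Lemma exp_gap (R : realType) (a r M : R) (n K : nat) :
  0 < a -> a < r -> 1 < M ->
  K%:R <= ln (r / a) / (4 * ln M) * n%:R ->
  M ^+ (2 * K) * a ^+ n <= expR (- (ln (r / a) / 2) * n%:R) * r ^+ n.
Proof.
move=> a0 ar M1 Kn.
have ra0 : 0 < r / a by rewrite divr_gt0 // (lt_trans a0).
have lM : 0 < ln M by rewrite ln_gt0.
have -> : r ^+ n = (r / a) ^+ n * a ^+ n by rewrite -exprMn divfK // gt_eqF.
rewrite mulrA ler_wpM2r ?exprn_ge0 ?(ltW a0) //.
rewrite -{1}(@lnK _ M) ?posrE ?(lt_trans ltr01) //.
rewrite -{2}(@lnK _ (r / a)) ?posrE // -!expRM_natl -expRD ler_expR.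
have : K%:R * (2 * ln M) <= ln (r / a) / (4 * ln M) * n%:R * (2 * ln M).
  by rewrite ler_wpM2r // mulr_ge0 ?ltW.
have -> : ln (r / a) / (4 * ln M) * n%:R * (2 * ln M) = ln (r / a) / 2 * n%:R.
  by field; rewrite gt_eqF.
rewrite natrM; lra.
Qed.

(** * Ballisticity *)

Theorem theorem4 (R : realType) (V : choiceType) (e : rel V)
    (e_sym : symmetric e) (e_irr : irreflexive e)
    (e_lf : locally_finite e) (e_vt : vertex_transitive e) (o : V)
    (mu_lt : (mu_p R e o < mu_w R e o)%E) :
  exists eps c : R, [/\ 0 < eps, 0 < c &
    forall n : nat,
      1 - expR (- c * n%:R) <=
      saw_prob R e o [set w : n.+1.-tuple V |
        ((eps * n%:R)%:E <= graph_dist R e o (endpoint w))%E]].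
Proof.
have mu_p0 : (0 <= mu_p R e o)%E.
  apply: limf_esup_ge0; last by move=> n; rewrite lee_fin powR_ge0.
  by move=> [N _ /(_ N)]; apply; exact: leqnn.
have [a a0 /andP[mu_a a_mu]] := ereal_between_pos mu_p0 mu_lt.
have [|r r0 /andP[+ r_mu]] := ereal_between_pos _ a_mu.
  by rewrite lee_fin ltW.
rewrite lte_fin => ar.
have [P hP] := power_series_bounded a0 mu_p0 mu_a.
have P0 : 0 <= P by have := hP 0%N; rewrite big_nil.
have saw_ge n : (0 < n)%N -> r ^+ n <= (saw_count e o n)%:R.
  by apply: submul_growth => // m k; apply: saw_count_submul.
(* M is at least c_1 B, the cost of one step of the short walk from o; the
   summand 2 makes the powers of M outgrow their partial sums. *)
pose B := a * (1 + P); pose M := 2 + (saw_count e o 1)%:R * B.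
have B0 : 0 <= B by rewrite mulr_ge0 ?addr_ge0 // ltW.
have M2 : 2 <= M by rewrite lerDl mulr_ge0.
have M1 : 1 < M by apply: lt_le_trans M2; rewrite ltr1n.
have la : 0 < ln (r / a) by rewrite ln_gt0 // ltr_pdivlMr // mul1r.
exists (ln (r / a) / (4 * ln M)), (ln (r / a) / 2); split.
- by rewrite divr_gt0 // mulr_gt0 // ln_gt0.
- by rewrite divr_gt0.
set eps := _ / (4 * _); have eps0 : 0 <= eps.
  by rewrite divr_ge0 ?mulr_ge0 ?ltW // ln_gt0.
move=> n; have [->|n0] := posnP n.
  by rewrite mulr0 expR0 subrr divr_ge0.
have sawn0 : 0 < (saw_count e o n)%:R :> R.
  by apply: lt_le_trans (saw_ge n n0); rewrite exprn_gt0.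
have en0 : 0 <= eps * n%:R by rewrite mulr_ge0.
set far := [set w : n.+1.-tuple V | _]; rewrite /saw_prob.
rewrite ler_pdivlMr // mulrBl mul1r lerBlDr -lerBlDl.
pose K := Num.truncn (eps * n%:R).
apply: (@le_trans _ _ (ncard (saws e o n `&` ~` far))%:R).
  have finS := (saw_countE o n e_lf).1.
  rewrite lerBlDl -natrD ler_nat; apply: ncard_setU; try exact: finite_setIl.
  by rewrite -setIUr setUv setIT.
apply: (@le_trans _ _ (M ^+ (2 * K) * a ^+ n)); last first.
  apply: le_trans (exp_gap a0 ar M1 _) _; first by rewrite truncn_le.
  by rewrite ler_wpM2l ?expR_ge0 // saw_ge.
apply: le_trans (ncard_near_le (o := o) (B := B) K e_lf e_vt _ B0 M2 _ n0 _).
- rewrite ler_nat; apply: ncard_saws_le.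
    by apply: sub_finite_set (finite_sawfrom o n e_lf) => s [].
  move=> w s sw /negP; rewrite -ltNge => /graph_dist_ltP[t [pt lt tn]] Ew.
  split; first by have [s' + ?] := sawsP sw; rewrite Ew => -[->].
  exists t; split=> //; first by rewrite lt (endpointE Ew).
  by rewrite /K truncn_ge_nat // ltW.
- exact: ltW.
- by rewrite lerDr.
- by move=> t pt; apply: sawto_bound.
Qed.
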